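(* Let $\eta\in(0,1/2)$. For all integers $d\ge2$, $N\ge1$ and every $\mathbf a\in\mathcal W(d,N)$, $$\frac{1}{\#\mathcal V}\#\Bigl\{\mathbf v\in\mathcal V:\operatorname{dist}_d(\mathbf a,\mathbf v)\in\Bigl[\sqrt{B_{\mathbf a,\mathcal V}}-\tfrac1{d^\eta},\sqrt{B_{\mathbf a,\mathcal V}}+\tfrac1{d^\eta}\Bigr]\Bigr\}\ge1-\frac{1}{d^{1-2\eta}}.$$
   Context: $\mathcal W(d,N)=\{0,1,\dots,N\}^d$, $\mathcal V=\mathcal V(d,N)=\{0,N\}^d$ (the vertices of $[0,N]^d$). The normalized distance is $\operatorname{dist}_d(\mathbf u,\mathbf v)=\frac{1}{\sqrt d\,N}\bigl(\sum_{j}(u_j-v_j)^2\bigr)^{1/2}$. $B_{\mathbf a,\mathcal V}=\frac{1}{\#\mathcal V}\sum_{\mathbf v\in\mathcal V}\operatorname{dist}_d^2(\mathbf a,\mathbf v)=\frac12-\frac{a_1+\cdots+a_d}{dN}+\frac{a_1^2+\cdots+a_d^2}{dN^2}$ is the average of the squared normalized distances from $\mathbf a$ to the vertices. *)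

(* Defs.v *)
From mathcomp Require Import all_boot all_order all_algebra.
From mathcomp Require Import reals exp.

Set Implicit Arguments.
Unset Strict Implicit.
Unset Printing Implicit Defensive.

Import Order.TTheory GRing.Theory Num.Theory.
Local Open Scope ring_scope.

Definition W (d N : nat) : finType := {ffun 'I_d -> 'I_N.+1}.

Definition V (d N : nat) : {set W d N} :=
  [set v : W d N | [forall j, ((v j : nat) == 0%N) || ((v j : nat) == N)]].

Definition dist (R : realType) (d N : nat) (u v : W d N) : R :=
  1 / (Num.sqrt d%:R * N%:R) *
  Num.sqrt (\sum_(j < d) ((u j)%:R - (v j)%:R) ^+ 2).

Definition B (R : realType) (d N : nat) (a : W d N) : R :=
  1 / #|V d N|%:R * \sum_(v in V d N) dist R a v ^+ 2.

(* Main.v *)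
Require Import Defs.
From mathcomp Require Import all_boot all_order all_algebra.
From mathcomp Require Import reals exp.
From mathcomp Require Import ring lra zify.

Import Order.TTheory GRing.Theory Num.Theory.
Local Open Scope ring_scope.

(** For a vertex [v], write [dist a v ^+ 2 = d^-1 * \sum_j (b_j + e_j(v) c_j)]
    with [c_j = a_j / N - 1 / 2], [b_j = 1 / 4 + c_j ^ 2] and signs
    [e_j(v) = 1 - 2 v_j / N].  Flipping one coordinate of [v] shows that the
    signs are centered and pairwise uncorrelated, so [dist ^+ 2] has mean
    [B = d^-1 * \sum_j b_j] and variance [d^-2 * \sum_j c_j ^ 2 <= B / d].
    Since [`|dist - sqrt B| * sqrt B <= `|dist ^+ 2 - B|], the factor [B]
    cancels in Chebyshev's inequality. *)

(** Markov's inequality in counting form: drop the nonnegative terms where [P] holds; each remaining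
    term is at least [m]. *)
Lemma chebyshev_card (R : realFieldType) (T : finType) (A : {set T})
    (P : pred T) (f : T -> R) (m : R) :
  (forall v, v \in A -> 0 <= f v) ->
  (forall v, v \in A -> ~~ P v -> m <= f v) ->
  (#|A|%:R - #|[set v in A | P v]|%:R) * m <= \sum_(v in A) f v.
Proof.
move=> f0 fm; rewrite -(cardsID [set v | P v] A) natrD.
have -> : A :&: [set v | P v] = [set v in A | P v].
  by apply/setP => v; rewrite !inE.
rewrite [X in X - _]addrC addrK (big_setID [set v | P v]) /=.
rewrite -[leLHS]add0r lerD //.
  by apply: sumr_ge0 => v; rewrite inE => /andP[/f0].
rewrite mulr_natl -sumr_const ler_sum // => v.
by rewrite !inE => /andP[nPv Av]; apply: fm.
Qed.

Section Vertices.
Variables (d N : nat).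

(** [rev_ord] sends [n] to [N - n], so it swaps the two vertex values 0 and [N]. *)
Definition flip (k : 'I_d) (v : W d N) : W d N :=
  [ffun j => if j == k then rev_ord (v j) else v j].

Lemma flipK k : involutive (flip k).
Proof. by move=> v; apply/ffunP => j; rewrite !ffunE; case: eqP; rewrite ?rev_ordK. Qed.

Lemma flip_V k v : (flip k v \in V d N) = (v \in V d N).
Proof.
rewrite !inE; apply: eq_forallb => j; rewrite ffunE; case: (j == k) => //=.
rewrite subSS; move: (ltn_ord (v j)); move: (nat_of_ord _) => n nN.
by apply/orP/orP => -[] /eqP nE; [right|left|right|left]; apply/eqP; lia.
Qed.

Lemma V_gt0 : (0 < #|V d N|)%N.
Proof.
by apply/card_gt0P; exists [ffun=> ord0]; rewrite inE; apply/forallP => j; rewrite ffunE.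
Qed.

Variables (R : realType) (hN : (0 < N)%N).

(** Affine in [v j], hence odd under the flip of coordinate [j] on the whole grid, not only at
    vertices. *)
Definition vsign (j : 'I_d) (v : W d N) : R := 1 - 2 * ((v j)%:R / N%:R).

Let N0 : N%:R != 0 :> R.
Proof. by rewrite pnatr_eq0 -lt0n. Qed.

Lemma vsign_flip k v : vsign k (flip k v) = - vsign k v.
Proof.
have vN : (v k <= N)%N by rewrite -ltnS.
have -> : vsign k (flip k v) = 1 - 2 * ((N - v k)%N%:R / N%:R).
  by rewrite /vsign ffunE eqxx.
by rewrite /vsign natrB //; field.
Qed.

Lemma vsign_flip_neq j k v : j != k -> vsign j (flip k v) = vsign j v.
Proof. by rewrite /vsign ffunE => /negbTE ->. Qed.

Lemma vsign_sqr j v : v \in V d N -> vsign j v ^+ 2 = 1.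
Proof.
rewrite inE => /forallP/(_ j); rewrite /vsign.
by case/orP => /eqP ->; [rewrite mul0r|rewrite divff //]; ring.
Qed.

(** Reindexing by the involution [flip k] shows that the sum equals its own opposite. *)
Lemma sum_V_flip_eq0 k (f : W d N -> R) :
  (forall v, f (flip k v) = - f v) -> \sum_(v in V d N) f v = 0.
Proof.
move=> fN; have: \sum_(v in V d N) f v = - \sum_(v in V d N) f v.
  rewrite {1}(reindex_inj (inv_inj (flipK k))) -sumrN.
  by apply: eq_big => [v|v _]; [exact: flip_V|exact: fN].
by move=> /eqP; rewrite -addr_eq0 -mulr2n mulrn_eq0 => /eqP.
Qed.

Lemma sum_V_vsign j : \sum_(v in V d N) vsign j v = 0.
Proof. by apply: (@sum_V_flip_eq0 j) => v; exact: vsign_flip. Qed.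

Lemma sum_V_vsignM j k : j != k ->
  \sum_(v in V d N) vsign j v * vsign k v = 0.
Proof.
by move=> jk; apply: (@sum_V_flip_eq0 k) => v; rewrite vsign_flip vsign_flip_neq // mulrN.
Qed.

Lemma sum_V_lin (c : 'I_d -> R) :
  \sum_(v in V d N) \sum_j vsign j v * c j = 0.
Proof.
by rewrite exchange_big big1 //= => j _; rewrite -mulr_suml sum_V_vsign mul0r.
Qed.

(** Expand the square: cross terms vanish because distinct signs are uncorrelated, and diagonal
    signs square to 1. *)
Lemma sum_V_lin_sqr (c : 'I_d -> R) :
  \sum_(v in V d N) (\sum_j vsign j v * c j) ^+ 2 =
  #|V d N|%:R * \sum_j c j ^+ 2.
Proof.
under eq_bigr => v _ do rewrite expr2 mulr_suml.
rewrite exchange_big mulr_sumr; apply: eq_bigr => j _ /=.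
under eq_bigr => v _ do rewrite mulr_sumr.
rewrite exchange_big (bigD1 j) //= [X in _ + X]big1 ?addr0 => [|k kj].
  rewrite mulr_natl -sumr_const; apply: eq_bigr => v Vv.
  by rewrite mulrACA -expr2 vsign_sqr // mul1r.
under eq_bigr => v _ do rewrite mulrACA.
by rewrite -mulr_suml sum_V_vsignM 1?eq_sym // mul0r.
Qed.

Variable a : W d N.

Definition offset (j : 'I_d) : R := (a j)%:R / N%:R - 1 / 2.

(** Coordinatewise, [(a j - v j) / N = offset j + vsign j v / 2]; in its square the sign survives
    only in the cross term. *)
Lemma dist_sqr v : v \in V d N ->
  dist R a v ^+ 2 = d%:R^-1 * (\sum_j (1 / 4 + offset j ^+ 2))
                    + d%:R^-1 * \sum_j vsign j v * offset j.
Proof.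
move=> Vv; rewrite /dist exprMn sqr_sqrtr ?sumr_ge0 // => [|j _]; last exact: sqr_ge0.
rewrite expr_div_n exprMn sqr_sqrtr ?ler0n // expr1n -mulrDr -big_split /=.
rewrite mul1r invfM -mulrA; congr (_ * _).
rewrite mulr_sumr; apply: eq_bigr => j _.
move: Vv; rewrite inE => /forallP/(_ j); rewrite /vsign /offset.
by case/orP => /eqP ->; field.
Qed.

Lemma B_offset : B R a = d%:R^-1 * \sum_j (1 / 4 + offset j ^+ 2).
Proof.
rewrite /B; under eq_bigr => v Vv do rewrite (dist_sqr _ Vv).
rewrite big_split /= -[X in _ * (_ + X)]mulr_sumr sum_V_lin mulr0 addr0 sumr_const -[X in _ * X = _]mulr_natl mulrA.
by rewrite mul1r mulVf ?mul1r // pnatr_eq0 -lt0n V_gt0.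
Qed.

(** Positivity comes from the constants [1 / 4]; it permits cancelling [B] at the end. *)
Lemma B_gt0 : (0 < d)%N -> 0 < B R a.
Proof.
move=> d0; rewrite B_offset mulr_gt0 ?invr_gt0 ?ltr0n //.
rewrite big_split /= sumr_const card_ord; apply: ltr_pwDl.
  by rewrite pmulrn_lgt0 // divr_gt0.
by apply: sumr_ge0 => j _; exact: sqr_ge0.
Qed.

Lemma variance_dist_sqr_le :
  \sum_(v in V d N) (dist R a v ^+ 2 - B R a) ^+ 2
  <= #|V d N|%:R * (B R a / d%:R).
Proof.
under eq_bigr => v Vv do rewrite (dist_sqr _ Vv) -B_offset addrC addKr exprMn.
rewrite -mulr_sumr sum_V_lin_sqr mulrCA ler_wpM2l ?ler0n // B_offset.
rewrite [leRHS]mulrAC -expr2 ler_wpM2l ?sqr_ge0 // ler_sum // => j _.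
by rewrite lerDr; lra.
Qed.

End Vertices.

(** In [(x - s) * (x + s)] the first factor exceeds [t] in absolute value and the second is at least
    [s]. *)
Lemma sqr_dev_ge (R : realDomainType) (x s t : R) : 0 <= x -> 0 <= s -> 0 <= t ->
  ~~ (s - t <= x <= s + t) -> t ^+ 2 * s ^+ 2 <= (x ^+ 2 - s ^+ 2) ^+ 2.
Proof.
move=> x0 s0 t0 H; rewrite subr_sqr exprMn.
apply: ler_pM; rewrite ?sqr_ge0 //; last by rewrite lerXn2r ?nnegrE ?addr_ge0 ?lerDr.
rewrite -[leRHS]real_normK ?num_real // lerXn2r ?nnegrE //.
by rewrite leNgt; apply: contra H => /ltW; rewrite ler_distl.
Qed.

Theorem theorem3p1 (R : realType) (eta : R) (heta : 0 < eta < 1 / 2)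
    (d N : nat) (hd : (2 <= d)%N) (hN : (1 <= N)%N) (a : W d N) :
  1 / #|V d N|%:R *
  #|[set v in V d N |
      Num.sqrt (B R a) - 1 / (d%:R `^ eta) <= dist R a v
        <= Num.sqrt (B R a) + 1 / (d%:R `^ eta)]|%:R
  >= 1 - 1 / (d%:R `^ (1 - 2 * eta)) :> R.
Proof.
have d0 : (0 < d)%N by apply: leq_trans hd.
have dR : 0 < d%:R :> R by rewrite ltr0n.
have V0 : 0 < #|V d N|%:R :> R by rewrite ltr0n V_gt0.
have B0 := @B_gt0 d N R hN a d0.
have p0 : 0 < d%:R `^ eta :> R by rewrite powR_gt0.
set G := [set v in _ | _].
(* The threshold is [t ^+ 2 * s ^+ 2] from [sqr_dev_ge], with [t = 1 / d ^ eta] and [s = sqrt B]. *)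
have : (#|V d N|%:R - #|G|%:R) * ((1 / d%:R `^ eta) ^+ 2 * B R a) <=
    #|V d N|%:R * (B R a / d%:R).
  apply: le_trans (@variance_dist_sqr_le d N R hN a).
  apply: chebyshev_card => v _; first exact: sqr_ge0.
  move=> /sqr_dev_ge; rewrite sqr_sqrtr ?(ltW B0) //; apply.
  - by rewrite /dist mulr_ge0 ?divr_ge0 ?mulr_ge0 ?sqrtr_ge0 ?ler0n.
  - exact: sqrtr_ge0.
  - by rewrite divr_ge0 // ltW.
(* Exhibit the threshold as a common positive factor; cancelling it removes [B]. *)
have -> : #|V d N|%:R * (B R a / d%:R) = #|V d N|%:R * (d%:R `^ eta ^+ 2 / d%:R)
    * ((1 / d%:R `^ eta) ^+ 2 * B R a).
  by field; rewrite !lt0r_neq0.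
rewrite ler_pM2r; last by rewrite mulr_gt0 // exprn_gt0 // divr_gt0.
move=> main.
have -> : d%:R `^ (1 - 2 * eta) = d%:R / d%:R `^ eta ^+ 2 :> R.
  rewrite powRB; last by rewrite lt0r_neq0 ?implybT.
  by rewrite powRr1 ?(ltW dR) // [2 * eta]mulrC powRrM powR_mulrn ?powR_ge0.
rewrite !div1r invf_div [leRHS]mulrC ler_pdivlMr // mulrBl mul1r [_ / _ * _]mulrC.
by rewrite lerBlDr -lerBlDl.
Qed.
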